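(* Suppose that $X$ is a continuum which has the property of Kelley. Then the following are equivalent: (1) $X$ is locally connected; (2) $C(X)$ is locally connected; (3) there exist $p,q\in X$ with $p\neq q$ such that $HS(p,X)$ and $HS(q,X)$ are locally connected.
   Context: A continuum is a nondegenerate (more than one point) compact connected metric space. For a continuum $X$ with metric $d$, $C(X)$ is the hyperspace of all subcontinua of $X$, i.e. all nonempty closed connected subsets of $X$ (singletons included), with the Hausdorff metric $H$. For $p\in X$, $C(p,X)=\{A\in C(X):p\in A\}$, and $HS(p,X)=C(X)/C(p,X)$ is the quotient space obtained from $C(X)$ by shrinking $C(p,X)$ to a single point. $X$ has the property of Kelley provided that for each $\varepsilon>0$ there exists $\delta>0$ such that if $p,q\in X$ satisfy $d(p,q)<\delta$ and $A\in C(X)$ satisfies $p\in A$, then there exists $B\in C(X)$ such that $q\in B$ and $H(A,B)<\varepsilon$. *)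

(* Defs.v *)
From HB Require Import structures.
From mathcomp Require Import all_boot all_order all_algebra.
From mathcomp Require Import generic_quotient.
From mathcomp Require Import all_classical all_reals all_analysis.

Set Implicit Arguments.
Unset Strict Implicit.
Unset Printing Implicit Defensive.

Import Order.TTheory GRing.Theory Num.Theory.

Local Open Scope classical_set_scope.
Local Open Scope ring_scope.
Local Open Scope quotient_scope.

HB.mixin Record Metric_isContinuum (R : realType) X & Metric R X := {
  continuum_compact : compact [set: X];
  continuum_connected : connected [set: X];
  continuum_nondegenerate : exists x y : X, x <> y
}.

#[short(type="continuumType")]
HB.structure Definition Continuum (R : realType) :=
  { X of Metric R X & Metric_isContinuum R X }.

Definition locally_connected (T : topologicalType) : Prop :=
  forall (x : T) (U : set T), nbhs x U ->
    exists V : set T, [/\ open V, connected V, V x & V `<=` U].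

Section Hyperspace.
Context {R : realType}.

(* The hyperspace C(X) of subcontinua, degenerate ones (singletons) included. *)
Record hyperspace (X : continuumType R) := Hyperspace {
  hyperspace_set :> set X;
  hyperspace_nonempty : hyperspace_set !=set0;
  hyperspace_closed : closed hyperspace_set;
  hyperspace_connected : connected hyperspace_set
}.

Context {X : continuumType R}.
Implicit Types A B C : hyperspace X.

HB.instance Definition _ := gen_eqMixin (hyperspace X).
HB.instance Definition _ := gen_choiceMixin (hyperspace X).

Definition metric_thickening (r : R) (S : set X) : set X :=
  [set x | exists2 a, S a & mdist x a < r].

Definition hausdorff_radii (S T : set X) : set R :=
  [set r | [/\ 0 < r, S `<=` metric_thickening r T
                    & T `<=` metric_thickening r S]].

(* The infimum is over a nonempty set, by compactness of X. *)
Definition hausdorff_dist (S T : set X) : R := inf (hausdorff_radii S T).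

Lemma hyperspace_inj A B : hyperspace_set A = hyperspace_set B -> A = B.
Proof.
case: A B => [A a1 a2 a3] [B b1 b2 b3] /= AB; subst B.
by congr Hyperspace; exact: Prop_irrelevance.
Qed.

Lemma continuum_bounded : exists2 M : R, 0 < M & forall x y : X, mdist x y < M.
Proof.
have [x0 _] := @continuum_nondegenerate R X.
have /compact_near_coveringP cX := @continuum_compact R X.
have [|N _ HN] := cX nat \oo (fun n x => mdist x0 x < n%:R) _.
  move=> x _; pose e := mdist x0 x + 1.
  exists (ball x 1, [set n | e < n%:R]) => /=.
    by split; [exact: nbhsx_ballx|exact: nbhs_infty_gtr].
  move=> [y n] /= []; rewrite ballEmdist/= => xy.
  by apply: lt_trans; apply: le_lt_trans (metric_triangle x0 x y) _;
    rewrite ltrD2l.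
have {}HN x : mdist x0 x < N%:R by apply: HN => //=.
have N0 : 0 < N%:R :> R by apply: le_lt_trans (HN x0); exact: mdist_ge0.
exists (N%:R + N%:R); first exact: addr_gt0.
move=> x y; apply: le_lt_trans (metric_triangle x x0 y) _.
by rewrite ltrD// metric_sym.
Qed.

Lemma hausdorff_radii_has_inf A B : has_inf (hausdorff_radii A B).
Proof.
split; last by exists 0 => r [/ltW].
have [M M0 HM] := continuum_bounded; exists M; split=> // x _.
- by have [b Bb] := hyperspace_nonempty B; exists b.
- by have [a Aa] := hyperspace_nonempty A; exists a.
Qed.

Lemma hausdorff_dist_lt A B (e : R) : hausdorff_dist A B < e ->
  exists2 r, hausdorff_radii A B r & r < e.
Proof.
move=> H; have [r rAB] := inf_adherent (eps := e - hausdorff_dist A B)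
  (ltac:(by rewrite subr_gt0)) (hausdorff_radii_has_inf A B).
by rewrite [X in _ < X]addrC subrK; exists r.
Qed.

Lemma hausdorff_dist_le A B r :
  hausdorff_radii A B r -> hausdorff_dist A B <= r.
Proof. by apply: ge_inf; exact: (hausdorff_radii_has_inf A B).2. Qed.

Lemma hausdorff_dist_ge0 A B : 0 <= hausdorff_dist A B.
Proof.
apply: lb_le_inf; first exact: (hausdorff_radii_has_inf A B).1.
by move=> r [/ltW].
Qed.

Lemma hausdorff_distC A B : hausdorff_dist A B = hausdorff_dist B A.
Proof.
rewrite /hausdorff_dist; congr inf.
by apply/seteqP; split=> r [? ? ?]; split.
Qed.

Lemma hausdorff_distxx A : hausdorff_dist A A = 0.
Proof.
apply/eqP; rewrite eq_le hausdorff_dist_ge0 andbT; apply/ler_addgt0Pl => e e0.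
by rewrite addr0; apply: hausdorff_dist_le; split=> // x Ax;
  exists x => //; rewrite mdistxx.
Qed.

Lemma hausdorff_dist0_sub A B : hausdorff_dist A B = 0 -> A `<=` B.
Proof.
move=> AB0 x Ax; apply: (hyperspace_closed (h := B)).
move=> U /nbhs_ballP[e /= e0 eU].
have [|r [_ AB _] re] := @hausdorff_dist_lt A B e; first by rewrite AB0.
have [b Bb xb] := AB _ Ax; exists b; split=> //; apply: eU.
by rewrite ballEmdist/=; exact: lt_trans re.
Qed.

Lemma hausdorff_dist_positivity A B : hausdorff_dist A B = 0 -> A = B.
Proof.
move=> AB0; apply/hyperspace_inj/seteqP; split.
  exact: hausdorff_dist0_sub.
by apply: hausdorff_dist0_sub; rewrite hausdorff_distC.
Qed.

Lemma hausdorff_dist_triangle B A C :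
  hausdorff_dist A C <= hausdorff_dist A B + hausdorff_dist B C.
Proof.
apply/ler_addgt0Pl => e e0.
have e20 : 0 < e / 2 by rewrite divr_gt0.
have [|r [r0 AB BA] re] := @hausdorff_dist_lt A B (hausdorff_dist A B + e / 2).
  by rewrite ltrDl.
have [|s [s0 BC CB] se] := @hausdorff_dist_lt B C (hausdorff_dist B C + e / 2).
  by rewrite ltrDl.
apply: (@le_trans _ _ (r + s)); last first.
  by rewrite (le_trans (ltW (ltrD re se)))// addrACA -splitr addrC.
apply: hausdorff_dist_le; split; first exact: addr_gt0.
- move=> x /AB[b /BC[c Cc bc] xb]; exists c => //.
  by apply: le_lt_trans (metric_triangle x b c) _; exact: ltrD.
- move=> x /CB[b /BA[a Aa ba] xb]; exists a => //.
  by apply: le_lt_trans (metric_triangle x b a) _; rewrite addrC; exact: ltrD.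
Qed.

HB.instance Definition _ := @isMetric.Build R (hyperspace X)
  (fun A B => hausdorff_dist A B) hausdorff_distxx hausdorff_dist_positivity
  hausdorff_distC hausdorff_dist_triangle.

Definition hyperspace_at (p : X) : set (hyperspace X) :=
  [set A : hyperspace X | (A : set X) p].

End Hyperspace.
Arguments hyperspace {R} X.

Section Shrink.
Context {T : topologicalType} (S : set T).

(* The equivalence relation whose only nontrivial class is S. *)
Definition shrink_rel : rel T :=
  fun x y => (x == y) || ((x \in S) && (y \in S)).

Lemma shrink_rel_refl : reflexive shrink_rel.
Proof. by move=> x; rewrite /shrink_rel eqxx. Qed.

Lemma shrink_rel_sym : symmetric shrink_rel.
Proof. by move=> x y; rewrite /shrink_rel eq_sym andbC. Qed.

Lemma shrink_rel_trans : transitive shrink_rel.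
Proof.
move=> y x z /orP[/eqP-> //|/andP[xS yS]] /orP[/eqP<-|/andP[_ zS]];
  by rewrite /shrink_rel ?xS ?yS ?zS orbT.
Qed.

Canonical shrink_equiv :=
  EquivRel shrink_rel shrink_rel_refl shrink_rel_sym shrink_rel_trans.

Definition shrink := quotient_topology {eq_quot shrink_equiv}.

HB.instance Definition _ := Topological.on shrink.

End Shrink.

(* HS(p, X) = C(X) / C(p, X) *)
Definition HS {R : realType} {X : continuumType R} (p : X) : topologicalType :=
  shrink (hyperspace_at p).

Definition kelley {R : realType} (X : continuumType R) : Prop :=
  forall eps : R, 0 < eps -> exists2 delta : R, 0 < delta &
    forall p q : X, mdist p q < delta ->
    forall A : hyperspace X, (A : set X) p ->
    exists2 B : hyperspace X, (B : set X) q & mdist A B < eps.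

(* Main.v *)
(* Each x differs from p or from q, and C(X) \ C(p, X) embeds as an open
   subspace of HS(p, X); so if HS(p, X) and HS(q, X) are locally connected then
   C(X) is locally connected at every singleton, and the union of a connected
   neighbourhood of {x} in C(X) is a small connected neighbourhood of x in X.
   Conversely let X be locally connected and let W be a connected open set
   around A inside a thickening of A.  For every subcontinuum B of W the order
   interval [B, cl W] of C(X) is connected: by Zorn's lemma a nonempty clopen
   part of it has a maximal element, and a member other than cl W can be
   enlarged arbitrarily little by a small connected open set.  These intervals
   share the point cl W, and their union is a small connected neighbourhood
   of A. *)
Require Import Defs.
From mathcomp Require Import all_boot all_order all_algebra.
From mathcomp Require Import generic_quotient.
From mathcomp Require Import all_classical all_reals all_analysis.
From mathcomp Require Import lra.

Set Implicit Arguments.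
Unset Strict Implicit.
Unset Printing Implicit Defensive.

Import Order.TTheory GRing.Theory Num.Theory.

Local Open Scope classical_set_scope.
Local Open Scope ring_scope.

(** * Local connectedness *)

Lemma open_connected_component (T : topologicalType) (U : set T) (x : T) :
  (forall (y : T) (V : set T), nbhs y V ->
     exists W, [/\ nbhs y W, connected W & W `<=` V]) ->
  open U -> open (connected_component U x).
Proof.
move=> cik oU; rewrite openE => y Uxy.
have Uy : U y := connected_component_sub Uxy.
have [W [nW cW WU]] := cik y U (open_nbhs_nbhs (conj oU Uy)).
apply: (filterS _ nW); rewrite (same_connected_component Uxy).
by apply: connected_component_max => //; exact: nbhs_singleton nW.
Qed.

Lemma locally_connected_open_component (T : topologicalType) :
  (forall (U : set T) x, open U -> open (connected_component U x)) ->
  locally_connected T.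
Proof.
move=> H x U; rewrite nbhsE => -[V [oV Vx] VU].
exists (connected_component V x); split.
- exact: H.
- exact: component_connected.
- exact: connected_component_refl.
- exact: subset_trans (@connected_component_sub _ _ _) VU.
Qed.

(** [cik] abbreviates connected im kleinen. Connected neighbourhoods that need not be open suffice
    when every point has them, since components of open sets are then open. *)
Lemma locally_connected_cik (T : topologicalType) :
  (forall (x : T) (U : set T), nbhs x U ->
     exists W, [/\ nbhs x W, connected W & W `<=` U]) ->
  locally_connected T.
Proof.
move=> cik; apply: locally_connected_open_component => U x.
exact: open_connected_component.
Qed.

Lemma locally_connected_componentP (T : topologicalType) :
  locally_connected T <->
  forall (U : set T) x, open U -> open (connected_component U x).
Proof.
split; last exact: locally_connected_open_component.
move=> lcT U x; apply: open_connected_component => y V /lcT[W [oW cW Wy WV]].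
by exists W; split=> //; exact: open_nbhs_nbhs.
Qed.

(** The preimage of a component of [U] is a union of components of the preimage of [U]: each of
    these has connected image, hence maps into a single component. *)
Lemma locally_connected_quotient (T : topologicalType) (Q : quotType T) :
  locally_connected T -> locally_connected (quotient_topology Q).
Proof.
move=> /locally_connected_componentP lcT.
apply/locally_connected_componentP => U x oU.
pose f : T -> quotient_topology Q := \pi_(quotient_topology Q)%qT.
have cf : continuous f by exact: pi_continuous.
suff : open (f @^-1` connected_component U x) by [].
rewrite openE => t xt.
have Ut : (f @^-1` U) t := connected_component_sub xt.
have oC : open (connected_component (f @^-1` U) t).
  by apply: lcT; by move/continuousP: cf; apply.
apply: (@filterS _ _ _ (connected_component (f @^-1` U) t)); last first.
  by apply: open_nbhs_nbhs; split => //; exact: connected_component_refl.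
move=> s ts; rewrite /preimage/= (same_connected_component xt).
apply: (@connected_component_max _ U (f @` connected_component (f @^-1` U) t)).
- by exists t => //; exact: connected_component_refl.
- by move=> _ [r /connected_component_sub Ur <-].
- apply: connected_continuous_connected; first exact: component_connected.
  exact: continuous_subspaceT.
- by exists s.
Qed.

Lemma shrink_pi_inj (T : topologicalType) (S : set T) (x y : T) :
  ~ S x -> \pi_(shrink S)%qT x = \pi_(shrink S)%qT y -> x = y.
Proof.
move=> Sx /eqmodP /orP[/eqP//|/andP[]].
by rewrite inE.
Qed.

(** Off the closed set [S] the projection is injective and open, so it identifies the complement of
    [S] with an open subspace of the quotient. *)
Lemma shrink_locally_connected_at (T : topologicalType) (S : set T) (x : T)
    (U : set T) :
  closed S -> locally_connected (shrink S) -> ~ S x -> nbhs x U ->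
  exists V, [/\ open V, connected V, V x & V `<=` U].
Proof.
move=> cS lcS Sx; rewrite nbhsE => -[U0 [oU0 U0x] U0U].
pose f : T -> shrink S := \pi_(shrink S)%qT.
have cf : continuous f by exact: pi_continuous.
have fopen O : open O -> O `<=` ~` S -> open (f @` O).
  move=> oO OS; suff : open (f @^-1` (f @` O)) by [].
  rewrite (_ : f @^-1` _ = O) //; apply/seteqP; split=> t; last by exists t.
  by move=> [s Os fst]; rewrite -(shrink_pi_inj (OS _ Os) fst).
pose O := U0 `&` ~` S.
have oO : open O by apply: openI => //; exact: closed_openC.
have OS : O `<=` ~` S by move=> ? [].
have [|V [oV cV Vx VO]] := lcS (f x) (f @` O).
  by apply: open_nbhs_nbhs; split; [exact: fopen|exists x].
have VfO t : V (f t) -> O t.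
  by move=> /VO[s Os fst]; rewrite -(shrink_pi_inj (OS _ Os) fst).
have reprf t : V (f t) -> repr (f t) = t.
  move=> /VfO/OS St; apply/esym/(shrink_pi_inj St).
  by rewrite reprK.
exists (f @^-1` V); split => //.
(* [repr] inverts [f] on [V], so this preimage is connected once [repr] is continuous on [V]. *)
- rewrite (_ : f @^-1` V = repr @` V); last first.
    apply/seteqP; split=> t.
      by move=> Vt; exists (f t) => //; exact: reprf.
    by move=> [v Vv <-]; rewrite /preimage/= /f reprK.
  apply: connected_continuous_connected => //.
  rewrite continuous_open_subspace// => v; rewrite inE => Vv N.
  rewrite nbhsE => -[M [oM Mv] MN].
  change (nbhs (v : shrink S) (repr @^-1` N)).
  have oMV : open (f @` (M `&` f @^-1` V)).
    apply: fopen; first exact: openI.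
    by move=> t [_ /VfO[]].
  apply: (@filterS _ _ _ (f @` (M `&` f @^-1` V))).
    by move=> _ [t [Mt Vt] <-]; apply: MN; rewrite reprf.
  apply: open_nbhs_nbhs; split => //; exists (repr v); last by rewrite /f reprK.
  by split => //; rewrite /preimage/= /f reprK.
- by move=> t /VfO[/U0U].
Qed.

Section Hyperspace.
Context {R : realType} {X : continuumType R}.
Implicit Types (A B C : hyperspace X) (S W D : set X).

(** * Hausdorff distance and thickenings *)

Lemma subset_thickening (r : R) S : 0 < r -> S `<=` metric_thickening r S.
Proof. by move=> r0 x Sx; exists x; rewrite ?mdistxx. Qed.

Lemma hyperspace_ball_sub A B (e : R) : ball A e B ->
  (A : set X) `<=` metric_thickening e B /\
  (B : set X) `<=` metric_thickening e A.
Proof.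
rewrite ballEmdist => /hausdorff_dist_lt[r [_ AB BA] re].
by split=> x => [/AB|/BA] [y Sy xy]; exists y => //; exact: lt_trans re.
Qed.

Lemma hyperspace_ball A B (r e : R) : 0 < r -> r < e ->
  (A : set X) `<=` metric_thickening r B ->
  (B : set X) `<=` metric_thickening r A -> ball A e B.
Proof.
move=> r0 re AB BA; rewrite ballEmdist/=.
by apply: le_lt_trans re; exact: hausdorff_dist_le.
Qed.

Lemma open_thickening (r : R) S : open (metric_thickening r S).
Proof.
rewrite openE => x [a Sa xa]; apply/nbhs_ballP.
exists (r - mdist x a); first by rewrite /= subr_gt0.
move=> y; rewrite ballEmdist/= => xy; exists a => //.
have := metric_triangle y x a; rewrite (metric_sym y x); lra.
Qed.

Lemma continuum_closed_compact S : closed S -> compact S.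
Proof.
by move=> cS; apply: (subclosed_compact cS (@continuum_compact R X)).
Qed.

(** A Lebesgue number argument: half of a radius that works at [x] works at all points within that
    half. *)
Lemma thickening_sub_open S W : compact S -> open W -> S `<=` W ->
  exists2 r : R, 0 < r & metric_thickening r S `<=` W.
Proof.
move=> /compact_near_coveringP cS oW SW.
have : \forall r \near (0 : R)^'+, S `<=` (fun x => ball x r `<=` W).
  apply: (cS R _ (fun r x => ball x r `<=` W)).
  move=> x /SW Wx.
  have /nbhs_ballP[e /= e0 xeW] : nbhs x W by exact: open_nbhs_nbhs.
  exists (ball x (e / 2), [set r | r < e / 2]) => /=.
    split; first by apply: nbhsx_ballx; rewrite divr_gt0.
    by apply: nbhs_right_lt; rewrite divr_gt0.
  move=> [y r] /= [xy re] z yz; apply: xeW; rewrite [e]splitr.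
  by apply: (ball_triangle xy); exact: le_ball (ltW re) _ yz.
move=> nr.
have nr0 : \forall r \near (0 : R)^'+, 0 < r by exact: nbhs_right_gt.
have [r [rW r0]] := filter_ex (filterI nr nr0).
exists r => // x [a Sa xa]; apply: (rW _ Sa).
by rewrite ballEmdist/= metric_sym.
Qed.

Lemma open_hyperspace_sub W :
  open W -> open [set A : hyperspace X | (A : set X) `<=` W].
Proof.
move=> oW; rewrite openE => A AW.
have [r r0 rW] := thickening_sub_open
  (continuum_closed_compact (hyperspace_closed (h := A))) oW AW.
apply/nbhs_ballP; exists r => // B /hyperspace_ball_sub[_ BA].
exact: subset_trans rW.
Qed.

Lemma closed_hyperspace_at (p : X) : closed (hyperspace_at p).
Proof.
rewrite -openC (_ : ~` _ =
    [set A : hyperspace X | (A : set X) `<=` ~` [set p]]); last first.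
  apply/seteqP; split=> A /= Ap; last by move/Ap; apply.
  by move=> x Ax xp; apply: Ap; rewrite /hyperspace_at/= -xp.
apply/open_hyperspace_sub/closed_openC/accessible_closed_set1.
exact/hausdorff_accessible/metric_hausdorff.
Qed.

(** A relatively clopen part [B] of the union contains or misses each connected member, so the
    members inside [B] form a clopen part of [V]. *)
Lemma connected_bigcup_hyperspace (V : set (hyperspace X)) :
  connected V -> connected (\bigcup_(A in V) (A : set X)).
Proof.
move=> cV; set U := (X in connected X); move=> B [b Bb] [Q oQ BQ] [D cD BD].
have dich A : V A -> (A : set X) `&` B !=set0 -> (A : set X) `<=` B.
  move=> VA AB; have AU : (A : set X) `<=` U by move=> x Ax; exists A.
  apply/setIidPl; apply: (@hyperspace_connected _ _ A) => //.
    by exists Q => //; rewrite BQ setIA (setIidl AU).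
  by exists D => //; rewrite BD setIA (setIidl AU).
have VB : V `&` [set A : hyperspace X | (A : set X) `<=` B] = V.
  apply: cV.
  - move: (Bb); rewrite {1}BQ => -[[A VA Ab] _].
    by exists A; split => //; apply: dich => //; exists b.
  - exists [set A : hyperspace X | (A : set X) `<=` Q].
      exact: open_hyperspace_sub.
    apply/seteqP; split=> A [VA AB]; split=> // x Ax.
      by have := AB _ Ax; rewrite BQ => -[].
    by rewrite BQ; split; [exists A|exact: AB].
  (* A member of [V] that meets [D] meets [B], hence lies in [B]; meeting a closed set is a closed
     condition. *)
  - exists (~` [set A : hyperspace X | (A : set X) `<=` ~` D]).
      exact/open_closedC/open_hyperspace_sub/closed_openC.
    apply/seteqP; split=> A [VA AB]; split=> //.
      move=> AD; have [a Aa] := hyperspace_nonempty A.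
      by apply: (AD _ Aa); have := AB _ Aa; rewrite BD => -[].
    apply: dich => //; apply: contrapT => AB0; apply: AB => x Ax Dx.
    by apply: AB0; exists x; split => //; rewrite BD; split => //; exists A.
apply/seteqP; split=> x; first by rewrite BQ => -[].
by move=> [A VA Ax]; move: VA; rewrite -VB => -[_]; apply.
Qed.

(** * Order intervals *)

(** Supplies the upper bounds for Zorn's lemma. By compactness a single member of the chain is
    already [e / 2]-dense in the closure of the union, so [M] is a Hausdorff limit of members. *)
Lemma chain_hyperspace_sup (F : set (hyperspace X)) :
  F !=set0 -> total_on F (fun A B => (A : set X) `<=` B) ->
  exists2 M : hyperspace X,
    (M : set X) = closure (\bigcup_(A in F) (A : set X)) & closure F M.
Proof.
move=> [A0 FA0] totF; set U := \bigcup_(A in F) (A : set X).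
have cU : connected (closure U).
  apply: connected_closure; have [a0 Aa0] := hyperspace_nonempty A0.
  (* The members that contain [a0] already cover the union, and they share that point. *)
  pose G := F `&` [set A : hyperspace X | (A : set X) a0].
  rewrite (_ : U = \bigcup_(A in G) (A : set X)).
    apply: bigcup_connected; first by exists a0 => A [].
    by move=> A _; exact: hyperspace_connected.
  apply/seteqP; split=> x; last by move=> [A [FA _] Ax]; exists A.
  move=> [A FA Ax]; have [A0A|AA0] := totF _ _ FA0 FA.
    by exists A => //; split => //; exact: A0A.
  by exists A0; [split|exact: AA0].
have AU A : F A -> (A : set X) `<=` closure U.
  by move=> FA; apply: subset_trans (@subset_closure _ _) => x Ax; exists A.
have U0 : closure U !=set0.
  by have [a Aa] := hyperspace_nonempty A0; exists a; exact: AU Aa.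
pose M := Hyperspace U0 (@closed_closure _ U) cU.
exists M => // N /nbhs_ballP[e /= e0 MeN].
(* Tails of the chain generate the filter along which compactness is applied. *)
pose above A := [set B | F B /\ (A : set X) `<=` B].
have FF : Filter (filter_from F above).
  apply: filter_from_filter; first by exists A0.
  move=> A B FA FB; have [AB|BA] := totF _ _ FA FB.
    exists B => // C [FC BC]; split; split => //.
    exact: subset_trans BC.
  by exists A => // C [FC A_C]; split; split => //; exact: subset_trans A_C.
have : \forall A \near filter_from F above,
    closure U `<=` metric_thickening (e / 2) (A : hyperspace X).
  have /compact_near_coveringP cpU :=
    continuum_closed_compact (@closed_closure _ U).
  apply: (cpU _ _ (fun A : hyperspace X => metric_thickening (e / 2) A)) => x.
  have e40 : 0 < e / 4 by rewrite divr_gt0.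
  move=> /(_ (ball x (e / 4)))[|y [[A FA Ay] xy]]; first exact: nbhsx_ballx.
  exists (ball x (e / 4), above A) => /=.
    by split; [exact: nbhsx_ballx|exists A].
  move=> [z B] /= [xz [FB AB]]; exists y; first exact: AB.
  move: xy xz; rewrite !ballEmdist/=; have := metric_triangle z x y.
  by rewrite (metric_sym z x); lra.
move=> [A FA HA]; exists A; split=> //; apply: MeN.
have e20 : 0 < e / 2 by rewrite divr_gt0.
apply: (@hyperspace_ball _ _ (e / 2)) => //; first by lra.
  by apply: (HA A); split.
exact: subset_trans (AU _ FA) (subset_thickening e20).
Qed.

(** The bounds are plain sets, so that [closure W] can serve as a bound without being packaged as a
    subcontinuum. *)
Definition order_interval S D : set (hyperspace X) :=
  [set C : hyperspace X | S `<=` (C : set X) /\ (C : set X) `<=` D].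

Lemma connected_order_interval B (K : hyperspace X) :
  (forall C (e : R), 0 < e -> order_interval B K C -> C <> K ->
     exists C', [/\ (C : set X) `<=` C', ~ ((C' : set X) `<=` C),
                    (C' : set X) `<=` K & ball C e C']) ->
  connected (order_interval B K).
Proof.
move=> ext; set I := order_interval _ _.
(* Closedness of [P] keeps suprema of chains in [P]; openness keeps a slight enlargement of a
   maximal element in [P], so that element must be [K]. *)
have clopenK P : P !=set0 -> (exists2 Q, open Q & P = I `&` Q) ->
    (exists2 D, closed D & P = I `&` D) -> P K.
  move=> [C0 PC0] [Q oQ PQ] [D cD PD].
  have subPQ A : P A -> I A /\ Q A by rewrite PQ.
  pose r (s t : {C | P C}) := `[< (sval s : set X) `<=` sval t >].
  have [||F totF|[C PC] maxC] := ZL_preorder (exist P C0 PC0) (R := r).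
  - by move=> t; exact/asboolP.
  - by move=> t s u /asboolP ts /asboolP su; apply/asboolP/(subset_trans ts).
  - have [[s0 Fs0]|F0] := pselect (F !=set0); last first.
      by exists (exist P C0 PC0) => s Fs; case: F0; exists s.
    have [||M ME clM] := @chain_hyperspace_sup (@sval _ _ @` F).
    + by exists (sval s0), s0.
    + move=> _ _ [s Fs <-] [t Ft <-].
      by have [/asboolP|/asboolP] := totF _ _ Fs Ft; [left|right].
    have sM s : F s -> (sval s : set X) `<=` M.
      move=> Fs; rewrite ME; apply: subset_trans (@subset_closure _ _) => x sx.
      by exists (sval s) => //; exists s.
    have PM : P M.
      rewrite PD; split; first split.
      + apply: subset_trans (sM _ Fs0).
        by have [[]] := subPQ _ (svalP s0).
      + rewrite ME (closure_id K).1; last exact: hyperspace_closed.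
        apply: closureS => x [_ [s _ <-] sx].
        by have [[_ sK] _] := subPQ _ (svalP s); exact: sK.
      + apply: cD; apply: closureS clM => _ [s _ <-].
        by have := svalP s; rewrite {1}PD => -[].
    by exists (exist P M PM) => s Fs; apply/asboolP; exact: sM.
  have [<-//|CK] := pselect (C = K).
  have [IC QC] : I C /\ Q C by exact: subPQ.
  have /nbhs_ballP[e e0 eQ] : nbhs C Q by exact: open_nbhs_nbhs.
  have [C' [CC' C'C C'K Ce]] := ext C e e0 IC CK.
  have PC' : P C'.
    rewrite PQ; split; last exact: eQ.
    by split => //; apply: subset_trans CC'; case: IC.
  exfalso; apply: C'C; apply/asboolP.
  by apply: (maxC (exist P C' PC')); exact/asboolP.
(* If [P] were proper, its complement in [I] would be a nonempty clopen part too, and both would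
   contain [K]. *)
move=> P P0 [Q oQ PQ] [D cD PD]; apply: contrapT => PI.
have [_ QK] : (I `&` Q) K by rewrite -PQ; apply: clopenK => //;
  [exists Q|exists D].
have : (I `\` P) K.
  apply: clopenK.
  - apply: contrapT => IP; apply: PI; apply/seteqP; split=> C.
      by rewrite PQ => -[].
    by move=> IC; apply: contrapT => PC; apply: IP; exists C.
  - exists (~` D); first exact: closed_openC.
    by rewrite PD setDE setCI setIUr setICr set0U.
  - exists (~` Q); first exact: open_closedC.
    by rewrite PQ setDE setCI setIUr setICr set0U.
by move=> [IK]; apply; rewrite PQ.
Qed.

(** [C] grows by the closure of a small connected neighbourhood of one of its points in [W] that is
    not interior to [C]. *)
Lemma continuum_extension W C (e : R) : locally_connected X ->
  open W -> connected W -> (C : set X) `&` W !=set0 ->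
  (C : set X) `<=` closure W -> (C : set X) <> closure W -> 0 < e ->
  exists C', [/\ (C : set X) `<=` C', ~ ((C' : set X) `<=` C),
                 (C' : set X) `<=` closure W & ball C e C'].
Proof.
move=> lcX oW cW [w [Cw Ww]] CW CneW e0.
(* Otherwise [C] would cut out a nonempty clopen part of the connected set [W], hence contain [W]
   and equal its closure. *)
have [c [[Cc Wc] ncC]] : exists c, ((C : set X) `&` W) c /\ ~ nbhs c (C : set X).
  apply: contrapT => H; apply: CneW; apply/seteqP; split => //.
  have -> : (C : set X) = closure C by exact/closure_id/hyperspace_closed.
  apply: closureS; apply/setIidPl; apply: cW.
  - by exists w.
  - exists (C : set X)°; first exact: open_interior.
    apply/seteqP; split=> x [Wx Cx]; split=> //; last exact: interior_subset.
    by apply: contrapT => nC; apply: H; exists x.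
  - by exists (C : set X) => //; exact: hyperspace_closed.
have e20 : 0 < e / 2 by rewrite divr_gt0.
have [|V [oV cV Vc VW]] := lcX c (W `&` ball c (e / 2)).
  by apply: filterI; [exact: open_nbhs_nbhs|exact: nbhsx_ballx].
have C'0 : (C : set X) `|` closure V !=set0 by exists w; left.
have C'cl : closed ((C : set X) `|` closure V).
  by apply: closedU; [exact: hyperspace_closed|exact: closed_closure].
have C'cn : connected ((C : set X) `|` closure V).
  apply: connectedU; last exact: connected_closure.
    by exists c; split => //; exact: subset_closure.
  exact: hyperspace_connected.
exists (Hyperspace C'0 C'cl C'cn); split => /=.
- exact: subsetUl.
- rewrite subUset => -[_ VC]; apply: ncC; apply: filterS VC _.
  apply: filterS (@subset_closure _ _) _; exact: open_nbhs_nbhs.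
- rewrite subUset; split => //; apply: closureS.
  exact: subset_trans VW (@subIsetl _ _ _).
(* [V] lies within [e / 2] of [c], and passing to its closure costs at most another [e / 4]. *)
- have e340 : 0 < e * (3 / 4) by rewrite mulr_gt0.
  apply: (@hyperspace_ball _ _ (e * (3 / 4))) => //=; first by lra.
    exact: subset_trans (@subsetUl _ _ _) (subset_thickening e340).
  rewrite subUset; split; first exact: subset_thickening.
  move=> y /(_ (ball y (e / 4)))[|v [/VW[_ cv] yv]].
    by apply: nbhsx_ballx; rewrite divr_gt0.
  exists c => //; move: cv yv; rewrite !ballEmdist/=.
  have := metric_triangle y v c; rewrite (metric_sym v c); lra.
Qed.

Lemma connected_order_interval_closure W B : locally_connected X ->
  open W -> connected W -> (B : set X) `<=` W ->
  connected (order_interval B (closure W)).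
Proof.
move=> lcX oW cW BW; have [b Bb] := hyperspace_nonempty B.
have W0 : closure W !=set0 by exists b; apply/subset_closure/BW.
pose K := Hyperspace W0 (@closed_closure _ W) (connected_closure cW).
apply: (@connected_order_interval B K) => C e e0 [BC CW] CK.
apply: continuum_extension => //.
- by exists b; split; [exact: BC|exact: BW].
- by move=> CWE; apply: CK; exact: hyperspace_inj.
Qed.

(** * The implications *)

Lemma locally_connected_hyperspace :
  locally_connected X -> locally_connected (hyperspace X).
Proof.
move=> lcX; apply: locally_connected_cik => A U /nbhs_ballP[e /= e0 AeU].
have e40 : 0 < e / 4 by rewrite divr_gt0.
have [a Aa] := hyperspace_nonempty A.
set T := metric_thickening (e / 4) A.
pose W := connected_component T a.
have oW : open W.
  apply: (locally_connected_componentP X).1 => //; exact: open_thickening.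
have cW : connected W by exact: component_connected.
have AW : (A : set X) `<=` W.
  apply: connected_component_max => //; first exact: subset_thickening.
  exact: hyperspace_connected.
have [d d0 dW] := thickening_sub_open
  (continuum_closed_compact (hyperspace_closed (h := A))) oW AW.
(* The bound [d] keeps every [B] of the ball inside [W]; the bound [e / 2] keeps [A] close to all
   continua above [B]. *)
pose m := Num.min d (e / 2).
have m0 : 0 < m by rewrite lt_min d0 divr_gt0.
have BW B : ball A m B -> (B : set X) `<=` W.
  move=> /hyperspace_ball_sub[_ BA] x /BA[y Ay xy]; apply: dW; exists y => //.
  by apply: lt_le_trans xy _; rewrite ge_min lexx.
(* Each [B] of the ball lies in its own interval, so the union is a neighbourhood of [A];
   [locally_connected_cik] does not ask for it to be open. *)
exists (\bigcup_(B in ball A m) order_interval B (closure W)); split.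
- apply/nbhs_ballP; exists m => //= B AB; exists B => //; split => //.
  exact: subset_trans (BW _ AB) (@subset_closure _ _).
- apply: bigcup_connected; last first.
    by move=> B /BW; exact: connected_order_interval_closure.
  have W0 : closure W !=set0 by exists a; apply/subset_closure/AW.
  exists (Hyperspace W0 (@closed_closure _ W) (connected_closure cW)).
  by move=> B /BW BW'; split => //=; exact: subset_trans (@subset_closure _ _).
- move=> C [B AB [BC CW]]; apply: AeU.
  (* [A] is within [e / 2] of [B], which [C] contains. A point of [C] is within [e / 4] of [W],
     whose points are within [e / 4] of [A]. *)
  apply: (@hyperspace_ball _ _ (e * (3 / 4))); [by rewrite mulr_gt0|by lra| |].
    have [+ _] := hyperspace_ball_sub AB => AB' x /AB'[y By xy].
    exists y; first exact: BC.
    apply: lt_trans xy _; apply: (@le_lt_trans _ _ (e / 2)); last by lra.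
    by rewrite ge_min lexx orbT.
  move=> x /CW /(_ (ball x (e / 4)))[|y [/connected_component_sub[z Az yz]]].
    exact: nbhsx_ballx.
  rewrite ballEmdist/= => xy; exists z => //.
  have := metric_triangle x y z; lra.
Qed.

Lemma hyperspace1_proof (x : X) :
  [/\ [set x] !=set0, closed [set x] & connected [set x]].
Proof.
split; [by exists x| |exact: connected1].
exact/accessible_closed_set1/hausdorff_accessible/metric_hausdorff.
Qed.

Definition hyperspace1 (x : X) : hyperspace X :=
  let: And3 ne cl cn := hyperspace1_proof x in Hyperspace ne cl cn.

Lemma hyperspace1E (x : X) : (hyperspace1 x : set X) = [set x].
Proof. by rewrite /hyperspace1; case: hyperspace1_proof. Qed.

Lemma locally_connected_HS (p q : X) : p <> q ->
  locally_connected (HS p) -> locally_connected (HS q) -> locally_connected X.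
Proof.
move=> pq lcp lcq; apply: locally_connected_cik => x U.
move=> /nbhs_ballP[e /= e0 xeU].
(* With [r] different from [x], the singleton of [x] lies outside the set that is shrunk in
   [HS r]. *)
have [r [rx lcr]] : exists r : X, r <> x /\ locally_connected (HS r).
  have [px|px] := pselect (p = x); last by exists p.
  by exists q; split => // qx; apply: pq; rewrite px.
have [||V [oV cV Vx VB]] := @shrink_locally_connected_at _ (hyperspace_at r)
    (hyperspace1 x) (ball (hyperspace1 x) e) (@closed_hyperspace_at r) lcr.
- by rewrite /hyperspace_at/= hyperspace1E.
- exact: nbhsx_ballx.
exists (\bigcup_(A in V) (A : set X)); split.
- have /nbhs_ballP[d /= d0 xdV] : nbhs (hyperspace1 x) V.
    exact: open_nbhs_nbhs.
  apply/nbhs_ballP; exists (d / 2); first by rewrite /= divr_gt0.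
  move=> y; rewrite ballEmdist/= => xy.
  exists (hyperspace1 y); last by rewrite hyperspace1E.
  (* Singletons of nearby points are close in the hyperspace; [d] was halved because
     [hyperspace_ball] asks for a strictly smaller thickening radius. *)
  apply/xdV/(@hyperspace_ball _ _ (d / 2)); [by rewrite divr_gt0|by lra| |];
    rewrite !hyperspace1E => _ ->.
    by exists y.
  by exists x => //; rewrite metric_sym.
- exact: connected_bigcup_hyperspace.
- move=> y [A /VB /hyperspace_ball_sub[_ Ax] /Ax].
  rewrite hyperspace1E => -[_ -> yx]; apply: xeU.
  by rewrite ballEmdist/= metric_sym.
Qed.

End Hyperspace.

Theorem theorem7p1 (R : realType) (X : continuumType R) (hX : kelley X) :
  [<-> locally_connected X;
       locally_connected (hyperspace X);
       exists p q : X, p <> q /\ locally_connected (HS p) /\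
                       locally_connected (HS q)].
Proof.
tfae.
- exact: locally_connected_hyperspace.
(* Any two distinct points serve, because quotients inherit local connectedness. *)
- move=> lc; have [p [q pq]] := @continuum_nondegenerate R X.
  by exists p, q; split=> //; split; exact: locally_connected_quotient.
- by move=> [p [q [pq [lcp lcq]]]]; exact: locally_connected_HS pq lcp lcq.
Qed.
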